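(* Let $f:\mathbb{R}^n\to\mathbb{R}\cup\{+\infty\}$, $b\in\mathbb{R}^q$, let $A$ be a $q\times n$ real matrix, and let $\theta$ be the dual function of the problem $\inf\{f(x): Ax\le b\}$, given by $$\theta(\lambda)=\inf_{x\in\mathbb{R}^n}\{f(x)+\lambda^T(Ax-b)\},\qquad\lambda\in\mathbb{R}^q.$$ Assume that the rows of $A$ are independent, that $f$ is convex, differentiable, and that $\nabla f$ is Lipschitz continuous with constant $L>0$ with respect to the norm $\|\cdot\|_2$. Then $\theta$ is strongly concave on $\mathbb{R}^q$ with constant of strong concavity $\frac{\lambda_{\min}(AA^T)}{L}$ with respect to the norm $\|\cdot\|_2$ on $\mathbb{R}^q$.
   Context: $\lambda_{\min}$ denotes the smallest eigenvalue. A function $h:\mathbb{R}^q\to\mathbb{R}\cup\{-\infty\}$ is strongly concave with constant $\alpha>0$ w.r.t. $\|\cdot\|_2$ if for all $x,y$ in $\mathrm{dom}(h)$ (the set where $h$ is finite) and all $t\in[0,1]$, $h(tx+(1-t)y)\ge th(x)+(1-t)h(y)+\frac{\alpha t(1-t)}2\|y-x\|_2^2$. *)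

(* Defs.v *)
From mathcomp Require Import all_boot all_order all_algebra.
From mathcomp Require Import all_classical all_reals all_analysis.
Set Implicit Arguments.
Unset Strict Implicit.
Unset Printing Implicit Defensive.
Import Order.TTheory GRing.Theory Num.Theory numFieldNormedType.Exports.
Local Open Scope classical_set_scope.
Local Open Scope ring_scope.

(* The norm that the library puts on 'cV[R]_n is the sup norm, hence a separate
   Euclidean norm. *)
Definition l2norm (R : realType) (n : nat) (x : 'cV[R]_n) : R :=
  Num.sqrt (\sum_(i < n) x i 0 ^+ 2).

Definition dotp (R : realType) (n : nat) (x y : 'cV[R]_n) : R :=
  (x^T *m y) 0 0.

(* For f with values in R u {+oo}: neither side can be an undefined sum, and
   0 * +oo = 0 makes the cases t = 0 and t = 1 trivial. *)
Definition econvex (R : realType) (n : nat) (f : 'cV[R]_n -> \bar R) : Prop :=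
  forall (x y : 'cV[R]_n) (t : R), 0 <= t <= 1 ->
    (f (t *: x + (1 - t) *: y)%R <= t%:E * f x + (1 - t)%:E * f y)%E.

(* As usual, an extended-real-valued function can be differentiable only at a
   point near which it is finite; fine then gives its real values. *)
Definition edifferentiable (R : realType) (n : nat) (f : 'cV[R]_n -> \bar R)
    (x : 'cV[R]_n) : Prop :=
  (\forall y \near x, f y \is a fin_num) /\ differentiable (fine \o f) x.

Definition gradient (R : realType) (n : nat) (f : 'cV[R]_n -> \bar R)
    (x : 'cV[R]_n) : 'cV[R]_n :=
  \col_(i < n) 'D_(delta_mx i 0) (fine \o f) x.

Definition l2lipschitz (R : realType) (n m : nat) (L : R)
    (F : 'cV[R]_n -> 'cV[R]_m) : Prop :=
  forall x y, l2norm (F x - F y) <= L * l2norm (x - y).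

Definition edom (R : realType) (n : nat) (h : 'cV[R]_n -> \bar R) :
    set 'cV[R]_n :=
  [set x | h x \is a fin_num].

(* The first condition says that h takes its values in R u {-oo}. *)
Definition strongly_concave (R : realType) (q : nat) (alpha : R)
    (h : 'cV[R]_q -> \bar R) : Prop :=
  [/\ forall x, h x != +oo%E,
      0 < alpha &
      forall (x y : 'cV[R]_q) (t : R), edom h x -> edom h y -> 0 <= t <= 1 ->
        (t%:E * h x + (1 - t)%:E * h y
           + (alpha * t * (1 - t) / 2 * l2norm (y - x) ^+ 2)%:E
         <= h (t *: x + (1 - t) *: y)%R)%E].

Definition dual_function (R : realType) (n q : nat) (f : 'cV[R]_n -> \bar R)
    (A : 'M[R]_(q, n)) (b : 'cV[R]_q) (lambda : 'cV[R]_q) : \bar R :=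
  ereal_inf (range (fun x : 'cV[R]_n =>
    (f x + (dotp lambda (A *m x - b)%R)%:E)%E)).

(* The default value 0 is taken only when M has no real eigenvalue, which cannot
   happen for a symmetric matrix of positive size. *)
Definition lambda_min (R : realType) (q : nat) (M : 'M[R]_q) : R :=
  xget 0 [set a | eigenvalue M a /\ forall c, eigenvalue M c -> a <= c].

(* Main.v *)
Require Import Defs.
From mathcomp Require Import all_boot all_order all_algebra.
From mathcomp Require Import all_classical all_reals all_analysis.
From mathcomp Require Import ring lra.
Set Implicit Arguments.
Unset Strict Implicit.
Unset Printing Implicit Defensive.
Import Order.TTheory GRing.Theory Num.Theory numFieldNormedType.Exports.
Local Open Scope classical_set_scope.
Local Open Scope ring_scope.

(** Write g for the real-valued function underlying f, and fix a point x. Since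
    the gradient of g is L-Lipschitz, g lies below a quadratic model at x
    ([descent]):
      g (x + d) <= g x + <grad g x, d> + L/2 |d|^2.
    The infimum defining theta(l) is therefore at most the minimum over d of
    this model plus the linear term <l, A (x + d) - b>. That minimum is reached
    by a gradient step of length 1/L ([gradient_step]), and gives
      theta(l) <= g x + <l, A x - b> - |u_l|^2 / (2 L),
                                          where u_l = grad g x + A^T l.
    The term in l is affine, so averaging the bounds for l and m with weights t
    and 1 - t gives the Lagrangian of t l + (1 - t) m at x, minus
    (t |u_l|^2 + (1 - t) |u_m|^2) / (2 L). By strong convexity of the squared
    norm ([dotp_convex_comb]) the latter is at least
    t (1 - t) |u_m - u_l|^2 / (2 L). The gradient of g cancels in
    u_m - u_l = A^T (m - l), whose squared norm is at least
    lambda_min(A A^T) |m - l|^2 ([lambda_min_gram_le]). Taking the infimum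
    over x gives strong concavity.

    The spectral facts about lambda_min come from minimizing the quadratic form
    of a symmetric matrix over the Euclidean unit sphere: the minimizer is an
    eigenvector for the least eigenvalue ([lambda_min_sym]). Independence of
    the rows of A makes this eigenvalue positive for the matrix A A^T
    ([lambda_min_gram_gt0]). *)

(** * Euclidean geometry of column vectors *)

Section DotProduct.
Context {R : realType} {n : nat}.
Implicit Types (x y z : 'cV[R]_n) (a c : R).

Lemma dotpE x y : dotp x y = \sum_(i < n) x i 0 * y i 0.
Proof. by rewrite /dotp !mxE; apply: eq_bigr => i _; rewrite mxE. Qed.

Lemma dotpC x y : dotp x y = dotp y x.
Proof. by rewrite !dotpE; apply: eq_bigr => i _; rewrite mulrC. Qed.

Lemma dotpDl x y z : dotp (x + y) z = dotp x z + dotp y z.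
Proof. by rewrite /dotp linearD mulmxDl mxE. Qed.

Lemma dotpZl a x y : dotp (a *: x) y = a * dotp x y.
Proof. by rewrite /dotp linearZ -scalemxAl mxE. Qed.

Lemma dotpNl x y : dotp (- x) y = - dotp x y.
Proof. by rewrite -scaleN1r dotpZl mulN1r. Qed.

Lemma dotpDr x y z : dotp x (y + z) = dotp x y + dotp x z.
Proof. by rewrite dotpC dotpDl !(dotpC x). Qed.

Lemma dotpZr a x y : dotp x (a *: y) = a * dotp x y.
Proof. by rewrite dotpC dotpZl (dotpC x). Qed.

Lemma dotpNr x y : dotp x (- y) = - dotp x y.
Proof. by rewrite dotpC dotpNl (dotpC x). Qed.

Definition dotp_lin := (dotpDl, dotpDr, dotpNl, dotpNr, dotpZl, dotpZr).

Lemma dotp_ge0 x : 0 <= dotp x x.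
Proof. by rewrite dotpE sumr_ge0// => i _; rewrite -expr2 sqr_ge0. Qed.

Lemma dotp_eq0 x : (dotp x x == 0) = (x == 0).
Proof.
apply/eqP/eqP => [|->]; last by rewrite /dotp mulmx0 mxE.
rewrite dotpE => /psumr_eq0P x0; apply/matrixP => i j; rewrite ord1 mxE.
by apply/eqP; rewrite -sqrf_eq0 expr2 x0// => k _; rewrite -expr2 sqr_ge0.
Qed.

Lemma dotp_gt0 x : (0 < dotp x x) = (x != 0).
Proof. by rewrite lt_def dotp_ge0 andbT dotp_eq0. Qed.

Lemma sqr_l2norm x : l2norm x ^+ 2 = dotp x x.
Proof.
rewrite /l2norm sqr_sqrtr ?dotpE.
  by apply: eq_bigr => i _; rewrite expr2.
by rewrite sumr_ge0// => i _; rewrite sqr_ge0.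
Qed.

Lemma l2normZ a x : 0 <= a -> l2norm (a *: x) = a * l2norm x.
Proof.
move=> a_ge0; apply: (pexpIrn (n := 2)) => //.
- by rewrite nnegrE sqrtr_ge0.
- by rewrite nnegrE mulr_ge0 ?sqrtr_ge0.
- by rewrite exprMn !sqr_l2norm !dotp_lin mulrA expr2.
Qed.

(** The instance of the Cauchy-Schwarz inequality that a Lipschitz bound calls
    for; it follows by expanding the square of x - c y. *)
Lemma dotp_le_l2norm x y c : 0 < c ->
  l2norm x <= c * l2norm y -> dotp x y <= c * dotp y y.
Proof.
move=> c_gt0 x_le.
have : l2norm x ^+ 2 <= (c * l2norm y) ^+ 2.
  by rewrite lerXn2r ?nnegrE ?mulr_ge0 ?sqrtr_ge0 // ltW.
rewrite exprMn !sqr_l2norm => x2_le.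
have := dotp_ge0 (x - c *: y); rewrite !dotp_lin (dotpC y x) => sq_ge0.
rewrite -(ler_pM2l c_gt0); nra.
Qed.

End DotProduct.

(** The difference of the two sides is the squared norm of t x + (1 - t) y. *)
Lemma dotp_convex_comb (R : realType) (n : nat) (x y : 'cV[R]_n) (t : R) :
  t * (1 - t) * dotp (y - x) (y - x) <= t * dotp x x + (1 - t) * dotp y y.
Proof.
have := dotp_ge0 (t *: x + (1 - t) *: y).
rewrite !dotp_lin (dotpC y x); lra.
Qed.

Lemma dotp_adj (R : realType) (m n : nat) (A : 'M[R]_(m, n)) x y :
  dotp x (A *m y) = dotp (A^T *m x) y.
Proof. by rewrite /dotp trmx_mul trmxK mulmxA. Qed.

(** * The least eigenvalue of a symmetric matrix *)

(** For s close to 0 the linear term dominates. The witness W / (K + W) is small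
    enough for that, and its denominator stays positive when K is 0. *)
Lemma parabola_ge0_slope (R : realFieldType) (K W : R) : 0 <= K -> 0 <= W ->
  (forall s, 0 <= - 2 * s * W + s ^+ 2 * K) -> W = 0.
Proof.
move=> K_ge0 W_ge0 ge0; apply/eqP; rewrite eq_le W_ge0 andbT leNgt.
apply/negP => W_gt0.
have KW : 0 < K + W by lra.
have := ge0 (W / (K + W)).
have -> : - 2 * (W / (K + W)) * W + (W / (K + W)) ^+ 2 * K =
  - (W ^+ 2 * (K + 2 * W)) / (K + W) ^+ 2 by field; rewrite gt_eqF.
rewrite leNgt mulNr oppr_lt0 divr_gt0 ?mulr_gt0 ?exprn_gt0//; lra.
Qed.

Section Rayleigh.
Context {R : realType} {q : nat}.
Implicit Types (M : 'M[R]_q) (x y : 'cV[R]_q).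

(** The argument is a row vector because the Heine-Borel and extreme value
    theorems are applied to row vectors. *)
Lemma quadratic_continuous M :
  continuous (fun v : 'rV[R]_q => dotp v^T (M *m v^T)).
Proof.
have coordE (v : 'rV[R]_q) : dotp v^T (M *m v^T) =
    \sum_i v 0 i * \sum_j M i j * v 0 j.
  rewrite dotpE; apply: eq_bigr => i _; rewrite !mxE; congr (_ * _).
  by apply: eq_bigr => j _; rewrite mxE.
move=> v; rewrite /continuous_at coordE; under eq_fun do rewrite coordE.
have coord_cvg i : w 0 i @[w --> v] --> v 0 i by exact: coord_continuous.
have nbhs_v : Filter (nbhs v) by exact: nbhs_filter.
apply: (cvg_big add_continuous nbhs_v) => i _.
have row_cvg : \sum_j M i j * w 0 j @[w --> v] --> \sum_j M i j * v 0 j.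
  apply: (cvg_big add_continuous nbhs_v) => j _.
  exact: (cvgM (cvg_cst _) (coord_cvg j)).
exact: (cvgM (coord_cvg i) row_cvg).
Qed.

Lemma unit_sphere_compact : compact [set v : 'rV[R]_q | dotp v^T v^T = 1].
Proof.
apply: bounded_closed_compact.
  (* boundedness refers to the sup norm, which the Euclidean norm dominates *)
  exists 1; split; first exact: num_real.
  move=> r r_gt1 v /= v1; apply: le_trans (ltW r_gt1).
  rewrite [leLHS]/Num.norm /= mx_normrE.
  apply/bigmax_leP; split => // -[i j] _ /=.
  rewrite ord1 -(expr_le1 (n := 2))// -normrX ger0_norm ?sqr_ge0// -v1 dotpE.
  rewrite (bigD1 j)//= mxE -expr2 lerDl sumr_ge0// => k _.
  by rewrite -expr2 sqr_ge0.
rewrite [X in closed X](_ : _ =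
    (fun v : 'rV[R]_q => dotp v^T (1%:M *m v^T)) @^-1` [set 1]); last first.
  by apply/seteqP; split=> v /=; rewrite mul1mx.
apply: closed_comp; last exact: closed_eq.
by move=> v _; exact: quadratic_continuous.
Qed.

(** An isotropic vector x minimizes a positive semidefinite form, so the form
    cannot decrease to first order when moving from x along - M x. *)
Lemma psd_isotropic M x : M^T = M -> (forall y, 0 <= dotp y (M *m y)) ->
  dotp x (M *m x) = 0 -> M *m x = 0.
Proof.
move=> M_sym M_psd x0; apply/eqP; rewrite -dotp_eq0.
set w := M *m x.
have wx : dotp x (M *m w) = dotp w w by rewrite dotp_adj M_sym.
have ge0 s : 0 <= - 2 * s * dotp w w + s ^+ 2 * dotp w (M *m w).
  have := M_psd (x - s *: w); rewrite mulmxBr -scalemxAr !dotp_lin wx x0.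
  by rewrite -/w; lra.
have K_ge0 := M_psd w; have w_ge0 := dotp_ge0 w.
exact/eqP/(parabola_ge0_slope K_ge0 w_ge0 ge0).
Qed.

(** The minimum m of the form of M over the unit sphere is the least eigenvalue.
    By homogeneity M - m I is positive semidefinite, and it is isotropic at the
    minimizer, which is thus an eigenvector for m; and evaluating the form at
    any eigenvector bounds its eigenvalue below by m. *)
Lemma lambda_min_sym M : (0 < q)%N -> M^T = M ->
  eigenvalue M (lambda_min M) /\
  forall x, lambda_min M * dotp x x <= dotp x (M *m x).
Proof.
move=> q_gt0 M_sym.
have normalize (v : 'cV[R]_q) : v != 0 -> exists2 a, 0 < a &
    dotp (a *: v) (a *: v) = 1.
  rewrite -dotp_gt0 -sqr_l2norm => v_gt0.
  have n_gt0 : 0 < l2norm v.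
    by rewrite lt_def sqrtr_ge0 andbT -sqrf_eq0 gt_eqF.
  exists (l2norm v)^-1; first by rewrite invr_gt0.
  by rewrite !dotp_lin -sqr_l2norm; field; rewrite gt_eqF.
pose form (v : 'rV[R]_q) := dotp v^T (M *m v^T).
have [u /[!inE] /= u1 u_min] : exists2 u,
    u \in [set v : 'rV[R]_q | dotp v^T v^T = 1] &
    forall v, v \in [set v : 'rV[R]_q | dotp v^T v^T = 1] -> form u <= form v.
  apply: (@EVT_min_rV _ _ form _ _ unit_sphere_compact).
    have [|a _ a1] := normalize (const_mx 1).
      apply/eqP => /matrixP /(_ (Ordinal q_gt0) 0) /eqP.
      by rewrite !mxE oner_eq0.
    by exists (a *: const_mx 1)^T; rewrite /= trmxK.
  by apply: continuous_subspaceT; exact: quadratic_continuous.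
rewrite /form in u_min; set m := dotp u^T (M *m u^T) in u_min.
have rayleigh x : m * dotp x x <= dotp x (M *m x).
  have [->|x_neq0] := eqVneq x 0.
    by rewrite mulmx0 /dotp mulmx0 mxE mulr0.
  have [a a_gt0 a1] := normalize _ x_neq0.
  have le_m : m * dotp (a *: x) (a *: x) <= dotp (a *: x) (M *m (a *: x)).
    by have := u_min (a *: x)^T; rewrite inE /= trmxK a1 mulr1; apply.
  move: le_m; rewrite -scalemxAr !dotp_lin => le_m.
  by rewrite -(ler_pM2l a_gt0) -(ler_pM2l a_gt0); lra.
have Mu : (M - m%:M) *m u^T = 0.
  apply: psd_isotropic => [|y|].
  - by rewrite linearB /= M_sym tr_scalar_mx.
  - by rewrite mulmxBl mul_scalar_mx !dotp_lin subr_ge0.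
  - by rewrite mulmxBl mul_scalar_mx !dotp_lin u1 mulr1 subrr.
have eig_m : eigenvalue M m.
  apply/eigenvalueP; exists u.
    apply: trmx_inj; rewrite trmx_mul M_sym linearZ /=.
    by apply/eqP; rewrite -subr_eq0 -mul_scalar_mx -mulmxBl Mu.
  apply: contra_eqN u1 => /eqP ->.
  by rewrite trmx0 /dotp mulmx0 mxE eq_sym oner_neq0.
have min_m c : eigenvalue M c -> m <= c.
  move=> /eigenvalueP[v vM v_neq0].
  have vT_neq0 : v^T != 0.
    by apply: contra_neq v_neq0 => v0; rewrite -[v]trmxK v0 trmx0.
  have := rayleigh v^T.
  rewrite -[in X in _ <= X]M_sym -trmx_mul vM linearZ /= dotpZr.
  by rewrite ler_pM2r ?dotp_gt0.
suff -> : lambda_min M = m by [].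
rewrite /lambda_min; case: xgetP => [c -> [/min_m le_mc /(_ m eig_m) le_cm]|].
  by apply/eqP; rewrite eq_le le_cm.
by move=> /(_ m) [].
Qed.

End Rayleigh.

Section GramMatrix.
Context {R : realType} {q n : nat}.
Context (A : 'M[R]_(q, n)) (q_gt0 : (0 < q)%N).

Lemma gram_sym : (A *m A^T)^T = A *m A^T.
Proof. by rewrite trmx_mul trmxK. Qed.

Lemma lambda_min_gram_le x :
  lambda_min (A *m A^T) * dotp x x <= dotp (A^T *m x) (A^T *m x).
Proof.
have [_ /(_ x)] := lambda_min_sym q_gt0 gram_sym.
by rewrite -mulmxA dotp_adj.
Qed.

(** If v is an eigenvector for the least eigenvalue m of A A^T, then m |v|^2 is
    the squared norm of v A, a nontrivial combination of the rows of A. *)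
Lemma lambda_min_gram_gt0 : row_free A -> 0 < lambda_min (A *m A^T).
Proof.
move=> A_free.
have [/eigenvalueP[v vM v_neq0] _] := lambda_min_sym q_gt0 gram_sym.
set m := lambda_min _ in vM *.
have vA_neq0 : (v *m A)^T != 0.
  rewrite -trmx0 (inj_eq trmx_inj).
  apply: contra_neq v_neq0 => vA0.
  by apply: (row_free_inj A_free); rewrite mul0mx.
have vT_neq0 : v^T != 0 by rewrite -trmx0 (inj_eq trmx_inj).
suff : 0 < m * dotp v^T v^T by rewrite pmulr_lgt0 ?dotp_gt0.
suff -> : m * dotp v^T v^T = dotp (v *m A)^T (v *m A)^T by rewrite dotp_gt0.
by rewrite -dotpZl /dotp !trmxK -linearZ/= -vM !trmx_mul !trmxK !mulmxA.
Qed.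

End GramMatrix.

(** * Functions with Lipschitz gradient *)

Section Descent.
Context {R : realType} {n : nat}.
Implicit Types (f : 'cV[R]_n -> \bar R) (x d : 'cV[R]_n).

Lemma derive_gradient f x d : differentiable (fine \o f) x ->
  'D_d (fine \o f) x = dotp (gradient f x) d.
Proof.
move=> df; rewrite deriveE// dotpE.
rewrite {1}(matrix_sum_delta d) linear_sum; apply: eq_bigr => i _ /=.
by rewrite big_ord1 linearZ /= mxE deriveE// mulrC.
Qed.

Lemma is_derive_line (g : 'cV[R]_n -> R) x d (s : R) :
  derivable g (s *: d + x) d ->
  is_derive s 1 (fun r : R => g (r *: d + x)) ('D_d g (s *: d + x)).
Proof.
have rateE : (fun h : R => h^-1 *: (g ((h *: 1 + s) *: d + x) - g (s *: d + x)))
    = (fun h : R => h^-1 *: (g (h *: d + (s *: d + x)) - g (s *: d + x))).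
  by apply/funext => h; rewrite scalerDl addrA [h *: 1]mulr1.
by move=> dg; apply: DeriveDef; rewrite /derivable /derive /= rateE.
Qed.

(** Along the segment from x to x + d, the difference phi between the function
    and its quadratic model has a nonpositive derivative, since the gradient at
    s d + x differs from the one at x by at most L s |d|. *)
Lemma descent f L x d : 0 < L ->
  (forall y, differentiable (fine \o f) y) -> l2lipschitz L (gradient f) ->
  fine (f (x + d)) <=
    fine (f x) + dotp (gradient f x) d + L / 2 * dotp d d.
Proof.
move=> L_gt0 df lip.
pose g := fine \o f.
pose c := dotp (gradient f x) d; pose k := L / 2 * dotp d d.
pose phi (s : R) := g (s *: d + x) - c * s - k * s ^+ 2.
have dg (s : R) : is_derive s 1 (fun r : R => g (r *: d + x))
    (dotp (gradient f (s *: d + x)) d).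
  rewrite -(derive_gradient d (df _)).
  exact/is_derive_line/diff_derivable.
have dphi (s : R) : is_derive s 1 phi
    (dotp (gradient f (s *: d + x)) d - c - L * s * dotp d d).
  rewrite (_ : phi = (fun r => g (r *: d + x)) - c *: id - k *: (id ^+ 2)).
    by apply: is_derive_eq; rewrite /k /= /GRing.scale /= ; lra.
  by apply/funext.
have phi_cont : continuous phi.
  move=> s; apply: differentiable_continuous; apply/derivable1_diffP.
  exact: ex_derive.
have : phi 1 <= phi 0.
  apply: (@ler0_derive1_le_cc _ phi 0 1) => //.
  - move=> s s01; rewrite derive1E derive_val.
    have s_gt0 : 0 < s by rewrite (itvP s01).
    rewrite /c -dotpNl -dotpDl.
    suff : dotp (gradient f (s *: d + x) - gradient f x) d <= L * s * dotp d d.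
      by lra.
    apply: dotp_le_l2norm; first exact: mulr_gt0.
    by apply: le_trans (lip _ _) _; rewrite addrK l2normZ ?(ltW s_gt0)// mulrA.
  - exact: continuous_subspaceT.
  - by rewrite in_itv/= ler01 lexx.
  - by rewrite in_itv/= ler01 lexx.
rewrite /phi /g /k /c /= !scale0r !scale1r !add0r (addrC d); lra.
Qed.

(** The point x - u / L minimizes the quadratic model at x of the function
    tilted by the linear form <v, .>, whose gradient at x is u. *)
Lemma gradient_step f L x v (u := gradient f x + v) : 0 < L ->
  (forall y, differentiable (fine \o f) y) -> l2lipschitz L (gradient f) ->
  fine (f (x - L^-1 *: u)) + dotp v (x - L^-1 *: u) <=
    fine (f x) + dotp v x - dotp u u / (2 * L).
Proof.
move=> L_gt0 df lip; have := descent x (- (L^-1 *: u)) L_gt0 df lip.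
have -> : gradient f x = u - v by rewrite addrK.
move: u => u; rewrite !dotp_lin invfM.
have : L * L^-1 = 1 by rewrite divff ?gt_eqF.
move: (dotp u u) (dotp v u) (dotp v x) (L^-1) => p r y i Li.
have -> : L / 2 * - - (i * (i * p)) = i / 2 * p.
  by rewrite -[i in RHS]mul1r -Li; lra.
by lra.
Qed.

End Descent.

(** * Strong concavity of the dual function *)

Theorem proposition2p7 (R : realType) (n q : nat) (q_gt0 : (0 < q)%N)
    (f : 'cV[R]_n -> \bar R) (b : 'cV[R]_q) (A : 'M[R]_(q, n)) (L : R)
    (f_codom : forall x, f x != -oo%E)
    (A_rows : row_free A)
    (f_convex : econvex f)
    (f_diff : forall x, edifferentiable f x)
    (L_gt0 : 0 < L)
    (f_lip : l2lipschitz L (gradient f)) :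
  strongly_concave (lambda_min (A *m A^T) / L) (dual_function f A b).
Proof.
have f_fin x : f x \is a fin_num by have [/nbhs_singleton] := f_diff x.
have f_EFin x : f x = (fine (f x))%:E by rewrite fineK.
have g_diff x : differentiable (fine \o f) x by have [] := f_diff x.
have dual_le l x :
    (dual_function f A b l <= (fine (f x) + dotp l (A *m x - b))%:E)%E.
  by rewrite EFinD -f_EFin; apply: ereal_inf_lbound; exists x.
have dual_le_grad l x : (dual_function f A b l <=
    (fine (f x) + dotp l (A *m x - b)
       - dotp (gradient f x + A^T *m l) (gradient f x + A^T *m l) / (2 * L))%:E)%E.
  set u := gradient f x + A^T *m l.
  apply: le_trans (dual_le l (x - L^-1 *: u)) _; rewrite lee_fin.
  have := gradient_step x (A^T *m l) L_gt0 g_diff f_lip.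
  by rewrite -/u !(dotpDr l) -!dotp_adj; lra.
split.
- move=> l; rewrite -ltey; exact: le_lt_trans (dual_le l 0) (ltry _).
- by rewrite divr_gt0 // lambda_min_gram_gt0.
move=> l m t l_fin m_fin /andP[t_ge0 t_le1].
apply/ereal_infP => _ [x _ <-].
set U := gradient f x + A^T *m l; set V := gradient f x + A^T *m m.
have := lambda_min_gram_le A q_gt0 (m - l).
have -> : A^T *m (m - l) = V - U by rewrite mulmxBr opprD addrACA subrr add0r.
have := dual_le_grad l x; have := dual_le_grad m x; rewrite -/U -/V.
rewrite -(fineK (l_fin : _ \is a fin_num)) -(fineK (m_fin : _ \is a fin_num)).
rewrite f_EFin -!EFinM -!EFinD !lee_fin sqr_l2norm.
rewrite (dotpDl (t *: l)) !dotpZl invfM.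
move: (lambda_min _) => lam le_m le_l lam_le.
have i_ge0 : 0 <= L^-1 / 2 by rewrite divr_ge0 ?invr_ge0 ?(ltW L_gt0).
have t'_ge0 : 0 <= 1 - t by rewrite subr_ge0.
have tt_ge0 : 0 <= t * (1 - t) by rewrite mulr_ge0.
have := le_trans (ler_wpM2l tt_ge0 lam_le) (dotp_convex_comb U V t).
move=> /(ler_wpM2l i_ge0).
have := lerD (ler_wpM2l t_ge0 le_l) (ler_wpM2l t'_ge0 le_m).
lra.
Qed.
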